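(* Let $V$ be a generalized complex vector space with structure $\mathcal J=\begin{pmatrix}\mathcal J_1&\mathcal J_2\\ \mathcal J_3&\mathcal J_4\end{pmatrix}$. A generalized complex subspace $W\subseteq V$ satisfies the graph condition with respect to the induced generalized complex structure if and only if $W$ is invariant under $\mathcal J_1$.
   Context: All vector spaces are finite-dimensional. For a real vector space $V$, $V_{\mathbb C}$ is its complexification, with complex conjugation $x\mapsto\bar x$; for $U\subseteq V$, $\operatorname{Ann}(U)\subseteq V^*$ is the annihilator. On $V\oplus V^*$ (and its complexification) use the pairing $\langle v+f,w+g\rangle=-\tfrac12(f(w)+g(v))$. A generalized complex (GC) structure on $V$ is an $\mathbb R$-linear automorphism $\mathcal J$ of $V\oplus V^*$ that is orthogonal for $\langle\cdot,\cdot\rangle$ and satisfies $\mathcal J^2=-1$. Equivalently, it is a maximally isotropic complex subspace $E\subset V_{\mathbb C}\oplus V_{\mathbb C}^*$ with $E\cap\overline E=(0)$; $E$ is the $+i$-eigenspace of $\mathcal J$. In the matrix form, $\mathcal J_1:V\to V$, $\mathcal J_2:V^*\to V$, $\mathcal J_3:V\to V^*$, $\mathcal J_4:V^*\to V^*$. A GC vector space is a real vector space with a GC structure. GC subspace: for a real subspace $W\subseteq V$ put $E_W=\{(w,f|_{W_{\mathbb C}}) : (w,f)\in E\cap(W_{\mathbb C}\oplus V_{\mathbb C}^* )\}$ (always a maximally isotropic subspace of $W_{\mathbb C}\oplus W_{\mathbb C}^*$). $W$ is a GC subspace if $E_W\cap\overline{E_W}=(0)$; then $E_W$ is the induced GC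 structure on $W$. Direct sum and twist: the direct sum of GC structures $\mathcal J_U$ on $U$ and $\mathcal J_V$ on $V$ is the structure on $U\oplus V$ given by $\mathcal J_U\oplus\mathcal J_V$ under the natural identification $(U\oplus V)\oplus(U\oplus V)^*\cong U\oplus U^*\oplus V\oplus V^*$. The twist of $\mathcal J$ is $\tilde{\mathcal J}=\begin{pmatrix}\mathcal J_1&-\mathcal J_2\\ -\mathcal J_3&\mathcal J_4\end{pmatrix}$. If $(W,\mathcal J_W)$, $(V,\mathcal J_V)$ are GC vector spaces, the twisted product structure on $W\oplus V$ is the direct sum of $\tilde{\mathcal J}_W$ and $\mathcal J_V$. A subspace $U$ of a GC vector space $(X,\mathcal J)$ is generalized isotropic if $\mathcal J(U)\subseteq U\oplus\operatorname{Ann}(U)$. A subspace $W\subseteq V$ equipped with a GC structure $\mathcal J_W$ satisfies the graph condition (with respect to $\mathcal J_W$) if the graph $\{(w,w):w\in W\}\subseteq W\oplus V$ of the inclusion is generalized isotropic for the twisted product structure on $W\oplus V$. *)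

(* Defs.v *)
From HB Require Import structures.
From mathcomp Require Import all_boot all_order all_algebra.
From mathcomp Require Import reals complex.

Set Implicit Arguments.
Unset Strict Implicit.
Unset Printing Implicit Defensive.

Import GRing.Theory.
Local Open Scope ring_scope.
Local Open Scope complex_scope.

Lemma linfun_linE (K : nzRingType) (U V : vectType K) (f : U -> V) :
  linear f -> linfun f =1 f.
Proof.
move=> flin x; pose F := GRing.isLinear.Build K U V *:%R f flin.
pose g : {linear U -> V} := HB.pack f F.
exact: (lfunE g).
Qed.

(* The complexification of V: the pair (x, y) stands for x + iy. *)
Definition cx (R : realType) (V : vectType R) : Type := (V * V)%type.

Section Complexification.
Context (R : realType) (V : vectType R).

HB.instance Definition _ := GRing.Zmodule.copy (cx V) (V * V)%type.

Definition cx_scale (a : R[i]) (x : cx V) : cx V :=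
  (Re a *: x.1 - Im a *: x.2, Re a *: x.2 + Im a *: x.1).

Fact cx_scaleA a b x : cx_scale a (cx_scale b x) = cx_scale (a * b) x.
Proof.
case: a b => [a a'] [b b']; rewrite /cx_scale /=; congr pair.
  rewrite !scalerBr !scalerDr !scalerBl !scalerDl !scalerA !opprD -!addrA.
  by congr (_ + _); rewrite addrA addrC.
rewrite !scalerBr !scalerDr !scalerBl !scalerDl !scalerA -!addrA.
by congr (_ + _); rewrite addrA addrC.
Qed.

Fact cx_scale1 : left_id 1 cx_scale.
Proof. by case=> x y; rewrite /cx_scale /= !scale1r !scale0r subr0 addr0. Qed.

Fact cx_scaleDr : right_distributive cx_scale +%R.
Proof.
move=> [a b] [x x'] [y y']; rewrite /cx_scale /=; congr pair.
  by rewrite !scalerDr opprD addrACA.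
by rewrite !scalerDr addrACA.
Qed.

Fact cx_scaleDl x : {morph cx_scale^~ x : a b / a + b}.
Proof.
case: x => x y [a a'] [b b']; rewrite /cx_scale /=; congr pair.
  by rewrite !scalerDl opprD addrACA.
by rewrite !scalerDl addrACA.
Qed.

HB.instance Definition _ := GRing.Zmodule_isLmodule.Build R[i] (cx V)
  cx_scaleA cx_scale1 cx_scaleDr cx_scaleDl.

Import VectorInternalTheory.

Fact cx_vect_iso : Vector.axiom (dim V) (cx V).
Proof.
exists (fun x : cx V => \row_j (v2r x.1 0 j +i* v2r x.2 0 j)).
  move=> a x y; apply/rowP=> j; rewrite !mxE /=.
  rewrite !(linearD, linearB, linearZ) /= !mxE.
  by case: a => a b; simpc; rewrite linearN !mxE mulrN.
exists (fun r : 'rV[R[i]]_(dim V) =>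
  (r2v (map_mx (@Re R) r), r2v (map_mx (@Im R) r))).
  move=> [x y] /=; congr pair; apply: v2r_inj; rewrite r2vK.
    by apply/rowP=> j; rewrite !mxE.
  by apply/rowP=> j; rewrite !mxE.
move=> r; apply/rowP=> j; rewrite !mxE /= !r2vK !mxE.
by case: (r 0 j).
Qed.

HB.instance Definition _ := Lmodule_hasFinDim.Build R[i] (cx V) cx_vect_iso.

Definition cx_of (x : V) : cx V := (x, 0).
Definition cx_re (x : cx V) : V := x.1.
Definition cx_conj (x : cx V) : cx V := (x.1, - x.2).

Lemma cx_scaleE (a : R[i]) (x : cx V) :
  a *: x = (Re a *: x.1 - Im a *: x.2, Re a *: x.2 + Im a *: x.1).
Proof. by []. Qed.

Lemma cx_addE (x y : cx V) : x + y = (x.1 + y.1, x.2 + y.2).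
Proof. by []. Qed.

Lemma cx_oppE (x : cx V) : - x = (- x.1, - x.2).
Proof. by []. Qed.

Lemma cx_ofE (x : cx V) : x = cx_of x.1 + 'i *: cx_of x.2.
Proof.
case: x => x y; rewrite cx_scaleE cx_addE /=.
by rewrite !scaler0 !scale0r !scale1r !subr0 !addr0 !add0r.
Qed.

Lemma cx_conjK : involutive cx_conj.
Proof. by case=> x y; rewrite /cx_conj /= opprK. Qed.

Lemma cx_conjD x y : cx_conj (x + y) = cx_conj x + cx_conj y.
Proof. by rewrite /cx_conj !cx_addE /= opprD. Qed.

Lemma cx_conjZ a x : cx_conj (a *: x) = a^*%C *: cx_conj x.
Proof.
case: a => a b; rewrite /cx_conj !cx_scaleE /= scaleNr scalerN opprK.
by rewrite scalerN scaleNr -opprD.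
Qed.

Lemma cx_conj0 : cx_conj 0 = 0.
Proof. by rewrite /cx_conj /= oppr0. Qed.

Lemma cx_conj_of x : cx_conj (cx_of x) = cx_of x.
Proof. by rewrite /cx_conj /= oppr0. Qed.

(* Conjugation is not R[i]-linear, hence the conjugate of a subspace is
   spanned by the conjugates of a basis; see memv_conjv. *)
Definition conjv (E : {vspace cx V}) : {vspace cx V} :=
  <<map cx_conj (vbasis E)>>%VS.

Lemma memv_conjv (E : {vspace cx V}) x : (x \in conjv E) = (cx_conj x \in E).
Proof.
have sub (s : seq (cx V)) y : y \in <<s>>%VS ->
    cx_conj y \in <<map cx_conj s>>%VS.
  move=> ys; rewrite (coord_span (ys : y \in <<in_tuple s>>%VS)).
  rewrite (big_morph cx_conj cx_conjD cx_conj0).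
  apply: memv_suml => i _; rewrite cx_conjZ memvZ //.
  by apply: memv_span; rewrite map_f // mem_nth.
apply/idP/idP => [/sub|xE].
  by rewrite (mapK cx_conjK) (span_basis (vbasisP E)).
by rewrite -[x]cx_conjK; apply: sub; rewrite (span_basis (vbasisP E)).
Qed.

Lemma conjvK : involutive conjv.
Proof. by move=> E; apply/vspaceP=> x; rewrite !memv_conjv cx_conjK. Qed.

End Complexification.


(* The complex-linear extension of f. *)
Definition cx_map (R : realType) (U V : vectType R) (f : 'Hom(U, V)) :
    'Hom(cx U, cx V) :=
  linfun (fun x : cx U => (f x.1, f x.2) : cx V).

Lemma cx_mapE (R : realType) (U V : vectType R) (f : 'Hom(U, V)) (x : cx U) :
  cx_map f x = (f x.1, f x.2).
Proof.
rewrite linfun_linE // => -[a b] {}x y.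
by rewrite !cx_scaleE !cx_addE /= !(linearD, linearB, linearZ) /= linearN.
Qed.

(* The complexification of a subspace U, as a subspace of the complexification
   of the ambient space. *)
Definition cx_space (R : realType) (V : vectType R) (U : {vspace V}) :
    {vspace cx V} :=
  limg (cx_map (linfun (vsval : subvs_of U -> V))).

Lemma memv_cx_space (R : realType) (V : vectType R) (U : {vspace V}) (x : cx V) :
  (x \in cx_space U) = (x.1 \in U) && (x.2 \in U).
Proof.
apply/memv_imgP/andP => [[y _ ->]|[x1U x2U]].
  by rewrite cx_mapE !lfunE /= !subvsP.
exists ((vsproj U x.1, vsproj U x.2) : cx (subvs_of U)); first exact: memvf.
by rewrite cx_mapE !lfunE /= !vsprojK //; case: (x).
Qed.

Section Products.
Context (R : realType) (U V : vectType R).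

Definition pfst : 'Hom((U * V)%type, U) := linfun fst.
Definition psnd : 'Hom((U * V)%type, V) := linfun snd.
Definition inj1 : 'Hom(U, (U * V)%type) := linfun (fun u => (u, 0)).
Definition inj2 : 'Hom(V, (U * V)%type) := linfun (fun v => (0, v)).

Definition prodv (A : {vspace U}) (B : {vspace V}) : {vspace (U * V)%type} :=
  (inj1 @: A + inj2 @: B)%VS.

Lemma inj1E u : inj1 u = (u, 0).
Proof.
rewrite linfun_linE // => a x y.
by congr pair; rewrite /= scaler0 addr0.
Qed.

Lemma inj2E v : inj2 v = (0, v).
Proof.
rewrite linfun_linE // => a x y.
by congr pair; rewrite /= scaler0 addr0.
Qed.

Lemma memv_prodv A B x : (x \in prodv A B) = (x.1 \in A) && (x.2 \in B).
Proof.
apply/memv_addP/andP => [[_ /memv_imgP[a aA ->]] [_ /memv_imgP[b bB ->] ->]|].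
  by rewrite inj1E inj2E /= add0r addr0.
case: x => a b /= [aA bB]; exists (inj1 a); first exact: memv_img.
exists (inj2 b); first exact: memv_img.
by rewrite inj1E inj2E; congr pair; rewrite /= ?add0r ?addr0.
Qed.

End Products.
Arguments pfst {R U V}.
Arguments psnd {R U V}.
Arguments inj1 {R U V}.
Arguments inj2 {R U V}.

Section Dual.
Context (R : realType) (V : vectType R).

Definition dual : vectType R := 'Hom(V, R^o).

Definition gspace : vectType R := (V * dual)%type.

Definition pairing (x y : gspace) : R :=
  - 2^-1 * ((x.2 : 'Hom(V, R^o)) y.1 + (y.2 : 'Hom(V, R^o)) x.1).

Definition restrict (W : {vspace V}) (f : 'Hom(V, R^o)) :
    'Hom(subvs_of W, R^o) :=
  (f \o linfun (vsval : subvs_of W -> V))%VF.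

Lemma restrictE (W : {vspace V}) f w : restrict W f w = f (vsval w).
Proof. by rewrite comp_lfunE lfunE. Qed.

Fact restrict_linear (W : {vspace V}) : linear (restrict W).
Proof. by move=> a f g; rewrite /restrict comp_lfunDl comp_lfunZl. Qed.

Definition Ann (W : {vspace V}) : {vspace dual} :=
  lker (linfun (restrict W) : 'Hom(dual, 'Hom(subvs_of W, R^o))).

Lemma memv_Ann (W : {vspace V}) (f : 'Hom(V, R^o)) :
  reflect (forall w, w \in W -> f w = 0) (f \in Ann W).
Proof.
rewrite memv_ker linfun_linE; last exact: restrict_linear.
apply: (iffP eqP) => [f0 w wW|f0].
  by rewrite -[w](vsprojK wW) -restrictE f0 lfunE.
by apply/lfunP => w; rewrite restrictE lfunE /= f0 // subvsP.
Qed.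

End Dual.

Section GeneralizedComplex.
Context (R : realType) (V : vectType R).
Implicit Types (J : 'End(gspace V)) (W : {vspace V}).
Implicit Types E : {vspace cx (gspace V)}.

Definition gc_structure J : Prop :=
  (forall x y, pairing (J x) (J y) = pairing x y) /\ (J \o J = - \1)%VF.

Definition eig_i J : {vspace cx (gspace V)} := passmx.leigenspace (cx_map J) 'i.

(* The real operator whose complexification is multiplication by i on E and by
   -i on the conjugate of E; it is meaningful when the complexification of
   V + V^* is the direct sum of E and its conjugate, see gc_of_sq, eig_i_gc_of,
   gc_of_orth and eig_iK. *)
Definition gc_of E : 'End(gspace V) :=
  linfun (fun x : gspace V =>
    cx_re ('i *: (daddv_pi E (conjv E) (cx_of x)
                  - daddv_pi (conjv E) E (cx_of x))) : gspace V).

(* (v, f) |-> (v, f|_W); it is only used for v in W, where vsproj W v is v seen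
   as a vector of W. *)
Definition restrict_pair W : 'Hom(gspace V, gspace (subvs_of W)) :=
  linfun (fun x : gspace V =>
    (vsproj W x.1, restrict W x.2) : gspace (subvs_of W)).

(* The space E_W. *)
Definition induced_space E W : {vspace cx (gspace (subvs_of W))} :=
  (cx_map (restrict_pair W) @: (E :&: cx_space (prodv W fullv)))%VS.

Definition gc_subspace J W : Prop :=
  (induced_space (eig_i J) W :&: conjv (induced_space (eig_i J) W) = 0)%VS.

Definition gcJ1 J : 'Hom(V, V) := (pfst \o J \o inj1)%VF.
Definition gcJ2 J : 'Hom(dual V, V) := (pfst \o J \o inj2)%VF.
Definition gcJ3 J : 'Hom(V, dual V) := (psnd \o J \o inj1)%VF.
Definition gcJ4 J : 'Hom(dual V, dual V) := (psnd \o J \o inj2)%VF.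

Definition gc_block (J1 : 'Hom(V, V)) (J2 : 'Hom(dual V, V))
    (J3 : 'Hom(V, dual V)) (J4 : 'Hom(dual V, dual V)) : 'End(gspace V) :=
  linfun (fun x : gspace V =>
    (J1 x.1 + J2 x.2, J3 x.1 + J4 x.2) : gspace V).

Definition twist J : 'End(gspace V) :=
  gc_block (gcJ1 J) (- gcJ2 J) (- gcJ3 J) (gcJ4 J).

Definition generalized_isotropic J (U : {vspace V}) : Prop :=
  (J @: (inj1 @: U) <= prodv U (Ann U))%VS.

End GeneralizedComplex.

Section DirectSum.
Context (R : realType) (U V : vectType R).

(* The natural identification of (U + V) + (U + V)^* with
   (U + U^* ) + (V + V^* ), and its inverse. *)
Definition gsplit : 'Hom(gspace (U * V)%type, (gspace U * gspace V)%type) :=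
  linfun (fun x : gspace (U * V)%type =>
    ((x.1.1, ((x.2 : 'Hom((U * V)%type, R^o)) \o inj1)%VF) : gspace U,
     (x.1.2, ((x.2 : 'Hom((U * V)%type, R^o)) \o inj2)%VF) : gspace V)).

Definition gjoin : 'Hom((gspace U * gspace V)%type, gspace (U * V)%type) :=
  linfun (fun y : (gspace U * gspace V)%type =>
    ((y.1.1, y.2.1),
     ((y.1.2 : 'Hom(U, R^o)) \o @pfst R U V)%VF
     + ((y.2.2 : 'Hom(V, R^o)) \o @psnd R U V)%VF) : gspace (U * V)%type).

Definition gc_dsum (JU : 'End(gspace U)) (JV : 'End(gspace V)) :
    'End(gspace (U * V)%type) :=
  (gjoin \o
   linfun (fun y : (gspace U * gspace V)%type => (JU y.1, JV y.2)) \o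
   gsplit)%VF.

Definition twisted_product (JU : 'End(gspace U)) (JV : 'End(gspace V)) :
    'End(gspace (U * V)%type) :=
  gc_dsum (twist JU) JV.

End DirectSum.

Definition inclusion_graph (R : realType) (V : vectType R) (W : {vspace V}) :
    {vspace (subvs_of W * V)%type} :=
  limg (linfun (fun w : subvs_of W => (w, vsval w))).

Definition graph_condition (R : realType) (V : vectType R)
    (J : 'End(gspace V)) (W : {vspace V}) (JW : 'End(gspace (subvs_of W))) :
    Prop :=
  generalized_isotropic (twisted_product JW J) (inclusion_graph W).

Definition induced (R : realType) (V : vectType R) (J : 'End(gspace V))
    (W : {vspace V}) : 'End(gspace (subvs_of W)) :=
  gc_of (induced_space (eig_i J) W).

(* Main.v *)
(** For [w] in [W], the graph condition says exactly that the induced structure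
    sends [(w, 0)] to [(J1 w, (J3 w)|_W)], which forces [J1 w] into [W].
    Conversely [(w, 0) - i J (w, 0)] lies in [E]; if [J1 w] lies in [W] then it
    restricts to the element [(w, 0) - i (J1 w, (J3 w)|_W)] of [E_W], so the
    induced structure does send [(w, 0)] to [(J1 w, (J3 w)|_W)]. *)
Require Import Defs.
From mathcomp Require Import all_boot all_order all_algebra.
From mathcomp Require Import reals complex.

Set Implicit Arguments.
Unset Strict Implicit.
Unset Printing Implicit Defensive.

Import GRing.Theory Num.Theory.
Local Open Scope ring_scope.
Local Open Scope complex_scope.

Lemma daddv_piD (K : fieldType) (vT : vectType K) (U V : {vspace vT}) u v :
  (U :&: V = 0)%VS -> u \in U -> v \in V -> daddv_pi U V (u + v) = u.
Proof.
move=> UV0 uU vV; have vUV : v \in (U + V)%VS by apply: (subvP (addvSr U V)).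
have VU0 : (V :&: U = 0)%VS by rewrite capvC.
(* The components of [v] along [U] and [V] add up to [v]; the one along [V] is already [v], so the
   one along [U] vanishes. *)
have := daddv_pi_add UV0 vUV; rewrite (daddv_pi_id VU0 vV).
move/(canRL (addrK v)); rewrite subrr linearD /= => ->.
by rewrite daddv_pi_id // addr0.
Qed.

Section GCOf.
Context (R : realType) (V : vectType R).
Implicit Types E : {vspace cx (gspace V)}.

Lemma gc_of_linear E : linear (fun x : gspace V =>
  cx_re ('i *: (daddv_pi E (conjv E) (cx_of x)
                - daddv_pi (conjv E) E (cx_of x))) : gspace V).
Proof.
move=> a x y.
have -> : cx_of (a *: x + y) = a%:C *: cx_of x + cx_of y.
  by rewrite cx_scaleE cx_addE /cx_of /= !scaler0 !scale0r subr0 !addr0.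
(* As a single complex-linear map, [D] carries the scalar [a%:C] through; being real, that scalar
   also passes through [cx_re]. *)
pose D := daddv_pi E (conjv E) - daddv_pi (conjv E) E.
have DE z : daddv_pi E (conjv E) z - daddv_pi (conjv E) E z = D z.
  by rewrite add_lfunE opp_lfunE.
rewrite !DE (linearP D) scalerDr scalerA mulrC -scalerA.
move: ('i *: D (cx_of x)) ('i *: D (cx_of y)) => u v.
by rewrite cx_scaleE cx_addE /cx_re /= scale0r subr0.
Qed.

(** With [z = x - iy] in [E], the vector [x] is the sum of [z/2] in [E] and its conjugate in
    [conjv E]. The difference of these two components is [-iy], and multiplying by [i] gives [y]. *)
Lemma gc_ofE E (x y : gspace V) :
  (E :&: conjv E = 0)%VS -> (x, - y) \in E -> gc_of E x = y.
Proof.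
move=> E0; set z : cx (gspace V) := (x, - y) => zE.
have E0' : (conjv E :&: E = 0)%VS by rewrite capvC.
have z'E : cx_conj z \in conjv E by rewrite memv_conjv cx_conjK.
(* 1/2 is kept abstract: unification diverges on the concrete inverse in R[i]. *)
have [c c2] : {c : R[i] | c * 2 = 1}.
  by exists 2^-1; rewrite mulVf // pnatr_eq0.
have xE : cx_of x = c *: z + c *: cx_conj z.
  rewrite -scalerDr -[LHS]scale1r -c2 -scalerA scaler_nat; congr (c *: _).
  by rewrite mulr2n !cx_addE /= opprK addNr addr0.
rewrite linfun_linE; last exact: gc_of_linear.
have -> : daddv_pi E (conjv E) (cx_of x) = c *: z.
  by rewrite xE daddv_piD // memvZ.
have -> : daddv_pi (conjv E) E (cx_of x) = c *: cx_conj z.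
  by rewrite xE addrC daddv_piD // memvZ.
have -> : c *: z - c *: cx_conj z = ((0, - y) : cx (gspace V)).
  rewrite -scalerBr -[RHS](@scale1r R[i] (cx (gspace V))) -c2 -scalerA
    scaler_nat; congr (c *: _).
  by rewrite mulr2n cx_oppE !cx_addE /= subrr opprK addr0.
by rewrite /cx_re cx_scaleE /= scale0r scale1r sub0r opprK.
Qed.

End GCOf.

Lemma pfstE (R : realType) (U V : vectType R) (x : (U * V)%type) :
  pfst x = x.1.
Proof. by rewrite linfun_linE. Qed.

Lemma psndE (R : realType) (U V : vectType R) (x : (U * V)%type) :
  psnd x = x.2.
Proof. by rewrite linfun_linE. Qed.

Lemma dsum_lfunE (R : realType) (U V Z : vectType R)
    (f : 'Hom(U, Z)) (g : 'Hom(V, Z)) u v :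
  ((f \o pfst)%VF + (g \o psnd)%VF) (u, v) = f u + g v.
Proof. by rewrite add_lfunE !comp_lfunE pfstE psndE. Qed.

Section Blocks.
Context (R : realType) (V : vectType R).
Implicit Types J : 'End(gspace V).

Lemma gcJ13E J v : J (v, 0) = (gcJ1 J v, gcJ3 J v).
Proof.
rewrite /gcJ1 /gcJ3 !comp_lfunE /= pfstE psndE inj1E.
by case: (J _).
Qed.

Lemma twist_inl J v : twist J (v, 0) = (gcJ1 J v, - gcJ3 J v).
Proof.
rewrite /twist /gc_block linfun_linE /=.
  by rewrite !linear0 !addr0 opp_lfunE.
by move=> a x y; congr pair; rewrite /= !linearP /= scalerDr addrACA.
Qed.

End Blocks.

Section Graph.
Context (R : realType) (V : vectType R).
Implicit Types (J : 'End(gspace V)) (W : {vspace V}).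

Lemma restrict_pairE W (x : gspace V) :
  restrict_pair W x = (vsproj W x.1, Defs.restrict W x.2).
Proof.
rewrite linfun_linE // => a y z.
by congr pair; rewrite /= ?linearP ?Defs.restrict_linear.
Qed.

(** Generalized isotropy only tests vectors with zero covector part, so just the first block columns
    enter, and of the signs of the twist only the one on [gcJ3 JU] survives. *)
Lemma twisted_product_inl (U : vectType R) (JU : 'End(gspace U)) J u v :
  twisted_product JU J ((u, v), 0) =
  ((gcJ1 JU u, gcJ1 J v),
   ((- gcJ3 JU u : 'Hom(U, R^o)) \o pfst)%VF
   + ((gcJ3 J v : 'Hom(V, R^o)) \o psnd)%VF).
Proof.
have gsplitE : gsplit U V ((u, v), 0) = ((u, 0), (v, 0)).
  rewrite linfun_linE /= ?comp_lfun0l // => a x y.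
  by congr pair; congr pair; rewrite /= ?comp_lfunDl ?comp_lfunZl.
have gjoinE y : gjoin U V y = ((y.1.1, y.2.1),
    ((y.1.2 : 'Hom(U, R^o)) \o pfst)%VF + ((y.2.2 : 'Hom(V, R^o)) \o psnd)%VF).
  rewrite linfun_linE // => a x z; congr pair; rewrite /=.
  by rewrite !comp_lfunDl scalerDr !comp_lfunZl addrACA.
rewrite /twisted_product /gc_dsum 2![LHS]comp_lfunE gsplitE
  [X in gjoin _ _ X]linfun_linE.
  by rewrite gjoinE twist_inl gcJ13E.
move=> a x y; congr pair; exact: linearP.
Qed.

(** The twisted product sends [(w, w)] to a vector part and a covector part. The vector part is on
    the graph exactly when the first equation holds. By the sign of the twist, the covector part
    takes on [(w', w')] the difference of the two sides of the second equation at [w']. *)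
Lemma graph_conditionP J W (JW : 'End(gspace (subvs_of W))) :
  graph_condition J JW <->
  forall w : subvs_of W,
    gcJ1 J (vsval w) = vsval (gcJ1 JW w) /\
    Defs.restrict W (gcJ3 J (vsval w)) = gcJ3 JW w.
Proof.
have graphE w : linfun (fun w : subvs_of W => (w, vsval w)) w = (w, vsval w).
  by rewrite linfun_linE // => a x y; congr pair; rewrite /= linearP.
have memG x : x \in inclusion_graph W = (x.2 == vsval x.1).
  apply/memv_imgP/eqP => [[w _ ->]|]; first by rewrite graphE.
  by case: x => w v /= ->; exists w; rewrite ?memvf ?graphE.
split=> [/subvP JG w | JG].
  have /JG : twisted_product JW J (inj1 (w, vsval w)) \in
      (twisted_product JW J @: (inj1 @: inclusion_graph W))%VS.
    by do 2!apply: memv_img; rewrite memG.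
  rewrite inj1E twisted_product_inl memv_prodv /= memG => /andP[/eqP /= -> ].
  move=> /memv_Ann JA; split=> //; apply/lfunP => w'; rewrite restrictE.
  (* The annihilator condition is tested at the graph point over [w']. *)
  have := JA (w', vsval w'); rewrite memG eqxx => /(_ isT).
  by rewrite dsum_lfunE opp_lfunE addrC => /subr0_eq.
apply/subvP => _ /memv_imgP[_ /memv_imgP[[w v] + ->] ->].
rewrite memG /= => /eqP ->; have [J1w J3w] := JG w.
rewrite inj1E twisted_product_inl memv_prodv /= memG /= J1w eqxx /=.
apply/memv_Ann => -[w' v']; rewrite memG /= => /eqP ->.
by rewrite dsum_lfunE opp_lfunE -J3w restrictE addNr.
Qed.

Lemma memv_eig_i J (z : cx (gspace V)) :
  (z \in eig_i J) = (cx_map J z == 'i *: z).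
Proof.
rewrite memv_ker add_lfunE opp_lfunE scale_lfunE id_lfunE.
by rewrite subr_eq0.
Qed.

(** Since [J] squares to -1, [J (x - iJx) = Jx + ix = i (x - iJx)]. *)
Lemma eig_i_subi J (x : gspace V) :
  (J \o J = - \1)%VF -> ((x, - J x) : cx (gspace V)) \in eig_i J.
Proof.
move=> JJ; have JJx : J (- J x) = x.
  by rewrite linearN /= -comp_lfunE JJ opp_lfunE id_lfunE opprK.
rewrite memv_eig_i cx_mapE cx_scaleE /= JJx.
by rewrite !scale0r !scale1r sub0r add0r opprK.
Qed.

Lemma induced_inl J W (w : subvs_of W) :
  (J \o J = - \1)%VF -> gc_subspace J W -> gcJ1 J (vsval w) \in W ->
  induced J W (w, 0) =
  (vsproj W (gcJ1 J (vsval w)), Defs.restrict W (gcJ3 J (vsval w))).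
Proof.
move=> JJ Wgc J1w; apply: gc_ofE => //.
apply/memv_imgP; exists (((vsval w, 0), - J (vsval w, 0)) : cx (gspace V)).
  (* Both real and imaginary parts must have their vector component in [W]: these are [w] and
     [- gcJ1 J w], whence the hypothesis on [gcJ1 J w]. *)
  rewrite memv_cap eig_i_subi // memv_cx_space gcJ13E !memv_prodv /=.
  by rewrite !memvf subvsP memvN J1w.
rewrite cx_mapE /= linearN /= gcJ13E !restrict_pairE /= vsvalK.
by rewrite /Defs.restrict comp_lfun0l.
Qed.

End Graph.

Theorem theorem2 (R : realType) (V : vectType R) (J : 'End(gspace V))
    (W : {vspace V}) :
  gc_structure J -> gc_subspace J W ->
  (graph_condition J (induced J W) <-> (gcJ1 J @: W <= W)%VS).
Proof.
move=> [_ JJ] Wgc; split=> [/graph_conditionP JW|/subvP J1W].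
  apply/subvP => _ /memv_imgP[w wW ->].
  by rewrite -[w](vsprojK wW) (JW _).1 subvsP.
apply/graph_conditionP => w.
have J1w : gcJ1 J (vsval w) \in W by apply/J1W/memv_img/subvsP.
(* Comparing components gives both equations; [J1w] undoes the projection to [W]. *)
have := induced_inl JJ Wgc J1w; rewrite gcJ13E => -[-> ->].
by rewrite vsprojK.
Qed.
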